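(* Let $R$ be a (commutative) principal ideal domain, presented as a quotient $R=\mathbb Z\langle\mathbf v\rangle/I$ of a free associative ring on an alphabet $\mathbf v$ by a two-sided ideal, let $\mathsf R$ be a multivariate Ore extension of $R$, and let $m=1$, i.e. $F=\{g_1,\dots,g_u\}\subset\mathsf R\setminus\{0\}$, $\mathbf M(g_i)=c_i\tau_i$. Assume that $\mathbb I_W(F)$ is an ideal of $\mathsf R$ and that for each $g_j\in F$ all the elements $Y_i\star g_j$ ($1\le i\le n$) and $g_j\star\alpha_\upsilon(v)$ ($v\in\mathbf v$, $\upsilon\in\mathcal T$, $\upsilon<\mathbf T(g_j)$) have a restricted representation in terms of $F$. Then for $1\le i<j\le u$: $$\mathbf M(i)\diamond\mathbf M(j)=\mathbf M(i,j)\iff\mathrm{lcm}(\tau_i,\tau_j)=\tau_i\tau_j\ \text{and}\ \mathrm{lcm}(c_i,c_j)=c_ic_j,$$ and if these equivalent conditions hold, then $0$ is a restricted (weak) normal form of $B_W(i,j)$ with respect to $F$, i.e. $\mathrm{NF}_W(B_W(i,j),F)=0$.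
   Context: **Ore extensions.** A multivariate Ore extension $\mathsf R=R[Y_1;\alpha_1,\delta_1]\cdots[Y_n;\alpha_n,\delta_n]$ of a domain $R$ is an iterated Ore extension ($Y_i\star r=\alpha_i(r)Y_i+\delta_i(r)$, $\alpha_i$ an injective ring endomorphism mapping $R$ to $R$, $\delta_i$ an $\alpha_i$-derivation mapping $R$ to $R$) such that $\alpha_j\delta_i=\delta_i\alpha_j$ for $i\ne j$, $\alpha_i\alpha_j=\alpha_j\alpha_i$, $\delta_i\delta_j=\delta_j\delta_i$, and $\alpha_j(Y_i)=Y_i$, $\delta_j(Y_i)=0$ for $i<j$. Its multiplication is $\star$. It is a free left $R$-module on the set of terms $\mathcal T=\{Y_1^{a_1}\cdots Y_n^{a_n}\}$, a commutative monoid. For $\tau=Y_1^{a_1}\cdots Y_n^{a_n}$, $\alpha_\tau=\alpha_1^{a_1}\cdots\alpha_n^{a_n}:R\to R$. Fix a term ordering $<$ on $\mathcal T$ (multiplicative well-ordering) such that $\{\omega\in\mathcal T:\omega<\tau\}$ is finite for every $\tau$. $\mathbf T(f)$, $\mathrm{lc}(f)$, $\mathbf M(f)=\mathrm{lc}(f)\mathbf T(f)$: maximal term, leading coefficient, maximal monomial. **Restricted notions.** $\mathbb I_W(F)$ is the left $R$-span of $\{g\star\rho:g\in F,\rho\in\mathcal T\}$. A restricted (weak Gröbner) representation of $f$ in terms of $F$ is $f=\sum_ia_i\,g_{\ell_i}\star\rho_i$ with $a_i\in R\setminus\{0\}$, $\rho_i\in\mathcal T$, $g_{\ell_i}\in F$,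 $\mathbf T(g_{\ell_i})\rho_i\le\mathbf T(f)$ for all $i$ (zero has the empty representation). $h$ is a restricted (weak) normal form of $f$ w.r.t. $F$ if $f-h$ has a restricted weak Gröbner representation in terms of $F$ and, if $h\ne0$, $\mathbf M(h)$ is not a sum of monomials $a\,\mathrm{lc}(g)\,\mathbf T(g)\rho$ with $a\in R\setminus\{0\}$, $g\in F$, $\rho\in\mathcal T$, $\mathbf T(g)\rho=\mathbf T(h)$. **The product $\diamond$ and S-polynomials.** $\diamond:\mathsf R\times\mathsf R\to\mathsf R$ is the biadditive commutative product with $c\tau\diamond c'\tau'=cc'\tau\tau'$ for monomials, so that $c\tau\diamond g=c\,g\star\tau$. Put $\mathbf M(i)=c_i\tau_i$, $\mathbf M(i,j)=\mathrm{lcm}(c_i,c_j)\,\mathrm{lcm}(\tau_i,\tau_j)$ (lcm's in $R$ being determined up to units, equalities involving them are understood up to a unit), and $$B_W(i,j)=\frac{\mathrm{lcm}(c_i,c_j)}{c_j}\,g_j\star\frac{\mathrm{lcm}(\tau_i,\tau_j)}{\tau_j}-\frac{\mathrm{lcm}(c_i,c_j)}{c_i}\,g_i\star\frac{\mathrm{lcm}(\tau_i,\tau_j)}{\tau_i}.$$ *)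

(* Defs.v *)
From HB Require Import structures.
From mathcomp Require Import all_boot all_order all_algebra.
From mathcomp Require Import boolp classical_sets.
From mathcomp.multinomials Require Import mpoly.
From mathcomp.multinomials Require monalg.

Set Implicit Arguments.
Unset Strict Implicit.
Unset Printing Implicit Defensive.

Import GRing.Theory.
Local Open Scope classical_set_scope.
Local Open Scope ring_scope.

Record two_sided_ideal (S : nzRingType) (I : set S) : Prop := TwoSidedIdeal {
  tsi_0 : I 0;
  tsi_add : forall x y, I x -> I y -> I (x + y);
  tsi_mull : forall a x, I x -> I (a * x);
  tsi_mulr : forall a x, I x -> I (x * a) }.

Definition is_pid (R : idomainType) : Prop :=
  forall I : set R, two_sided_ideal I -> exists a : R, I = [set b * a | b in setT].

(* monalg has its own {mpoly _[_]} notation, hence the confined Import. *)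
Module FreeRing.
Import monalg.

Definition free_ring (V : choiceType) : nzRingType := {malg int[{fmonom V}]}.

Definition free_gen (V : choiceType) (v : V) : free_ring V := << fmu v >>.

End FreeRing.

Notation free_ring := FreeRing.free_ring.
Notation free_gen := FreeRing.free_gen.

(* pi identifies R with the quotient of the free ring by the ideal I. *)
Record presentation (V : choiceType) (I : set (free_ring V)) (R : nzRingType)
    (pi : {rmorphism free_ring V -> R}) : Prop := Presentation {
  pres_ideal : two_sided_ideal I;
  pres_surj : forall r : R, exists x, pi x = r;
  pres_ker : forall x, pi x = 0 <-> I x }.

Section OreExtension.
Variable S : nzRingType.

Record subring (A : set S) : Prop := Subring {
  subring_1 : A 1;
  subring_sub : forall x y, A x -> A y -> A (x - y);
  subring_mul : forall x y, A x -> A y -> A (x * y) }.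

(* B = A[Y; alpha, delta], for subrings A and B of S. The maps alpha and delta
   are total on S, but only their restrictions to A are constrained.
   Horner evaluation of p : {poly S} puts the coefficients on the left:
   p.[Y] = \sum_k p`_k * Y ^+ k. *)
Record ore_extension (A B : set S) (Y : S) (alpha delta : S -> S) : Prop :=
    OreExtension {
  oe_subA : subring A;
  oe_subB : subring B;
  oe_incl : A `<=` B;
  oe_var : B Y;
  oe_alpha_stable : forall a, A a -> A (alpha a);
  oe_alpha_1 : alpha 1 = 1;
  oe_alpha_add : forall a b, A a -> A b -> alpha (a + b) = alpha a + alpha b;
  oe_alpha_mul : forall a b, A a -> A b -> alpha (a * b) = alpha a * alpha b;
  oe_alpha_inj : forall a b, A a -> A b -> alpha a = alpha b -> a = b;
  oe_delta_stable : forall a, A a -> A (delta a);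
  oe_delta_add : forall a b, A a -> A b -> delta (a + b) = delta a + delta b;
  oe_delta_mul : forall a b, A a -> A b ->
    delta (a * b) = alpha a * delta b + delta a * b;
  oe_comm : forall a, A a -> Y * a = alpha a * Y + delta a;
  oe_free : forall b, B b ->
    exists! p : {poly S}, (forall k, A p`_k) /\ b = p.[Y] }.

End OreExtension.

Section MultivariateOre.
Variables (R : idomainType) (S : nzRingType) (iota : {rmorphism R -> S}).
Variables (n : nat) (Y : 'I_n -> S) (alpha delta : 'I_n -> S -> S).

(* A k is the intermediate ring generated over R by the first k variables;
   alpha i and delta i act on A i. The commutation relations are imposed
   where both composites are defined. *)
Record ore_tower (A : nat -> set S) : Prop := OreTower {
  ot_base : A 0%N = [set iota r | r in setT];
  ot_step : forall i : 'I_n, ore_extension (A i) (A i.+1) (Y i) (alpha i) (delta i);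
  ot_top : A n = setT;
  ot_alpha_base : forall (i : 'I_n) (r : R), exists s : R, alpha i (iota r) = iota s;
  ot_delta_base : forall (i : 'I_n) (r : R), exists s : R, delta i (iota r) = iota s;
  ot_alpha_delta : forall (i j : 'I_n), i != j ->
    forall x, A (minn i j) x -> alpha j (delta i x) = delta i (alpha j x);
  ot_alpha_alpha : forall (i j : 'I_n) x, A (minn i j) x ->
    alpha i (alpha j x) = alpha j (alpha i x);
  ot_delta_delta : forall (i j : 'I_n) x, A (minn i j) x ->
    delta i (delta j x) = delta j (delta i x);
  ot_alpha_var : forall i j : 'I_n, (i < j)%N -> alpha j (Y i) = Y i;
  ot_delta_var : forall i j : 'I_n, (i < j)%N -> delta j (Y i) = 0 }.

Definition multivariate_ore : Prop :=
  injective iota /\ exists A : nat -> set S, ore_tower A.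

Definition term (m : 'X_{1..n}) : S := \prod_(i < n) Y i ^+ m i.

(* alpha_m = alpha_1^{m_1} o ... o alpha_n^{m_n} *)
Definition alpha_term (m : 'X_{1..n}) (x : S) : S :=
  foldr (fun i y => iter (m i) (alpha i) y) x (enum 'I_n).

(* The commutative polynomial ring serves as the free left R-module on the
   terms; of_coords is its linear map to S, bijective when S is a multivariate
   Ore extension, and coords is the inverse. *)
Definition of_coords (p : {mpoly R[n]}) : S :=
  \sum_(m <- msupp p) iota p@_m * term m.

Definition coords (f : S) : {mpoly R[n]} :=
  xget 0 [set p | of_coords p = f].

Definition diamond (f g : S) : S := of_coords (coords f * coords g).

End MultivariateOre.

Record term_order (n : nat) (lt : rel 'X_{1..n}) : Prop := TermOrder {
  to_irr : irreflexive lt;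
  to_trans : transitive lt;
  to_total : forall a b, a != b -> lt a b || lt b a;
  to_mul : forall a b c, lt a b -> lt (a + c)%MM (b + c)%MM;
  to_wf : well_founded (fun a b => is_true (lt a b)) }.

Definition finite_below (n : nat) (lt : rel 'X_{1..n}) : Prop :=
  forall t, exists s : seq 'X_{1..n}, forall w, lt w t -> w \in s.

Section Restricted.
Variables (R : idomainType) (S : nzRingType) (iota : {rmorphism R -> S}).
Variables (n : nat) (Y : 'I_n -> S) (lt : rel 'X_{1..n}).

Definition le_term (a b : 'X_{1..n}) : bool := (a == b) || lt a b.

(* Junk value: lead_term 0 = 0%MM, the exponent of the term 1. *)
Definition lead_term (f : S) : 'X_{1..n} :=
  \big[(fun a b => if lt a b then b else a) / 0%MM]_(m <- msupp (coords iota Y f)) m.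

Definition lead_coeff (f : S) : R := (coords iota Y f)@_(lead_term f).

Definition lead_mon (f : S) : S := iota (lead_coeff f) * term Y (lead_term f).

Variables (u : nat) (g : 'I_u -> S).

Definition I_W : set S :=
  [set f | exists s : seq (R * 'I_u * 'X_{1..n}),
     f = \sum_(x <- s) iota x.1.1 * (g x.1.2 * term Y x.2)].

(* The empty sequence represents 0, so the junk value of lead_term 0 does not
   affect the existence of a representation. *)
Definition restricted_rep (f : S) : Prop :=
  exists s : seq (R * 'I_u * 'X_{1..n}),
    f = \sum_(x <- s) iota x.1.1 * (g x.1.2 * term Y x.2) /\
    (forall x, x \in s ->
       x.1.1 != 0 /\ le_term (lead_term (g x.1.2) + x.2)%MM (lead_term f)).

Definition restricted_NF (f h : S) : Prop :=
  restricted_rep (f - h) /\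
  (h != 0 ->
   ~ exists s : seq (R * 'I_u * 'X_{1..n}),
       lead_mon h = \sum_(x <- s) iota (x.1.1 * lead_coeff (g x.1.2)) *
                                  term Y (lead_term (g x.1.2) + x.2)%MM /\
       (forall x, x \in s ->
          x.1.1 != 0 /\ (lead_term (g x.1.2) + x.2)%MM = lead_term h)).

End Restricted.

Definition is_lcm (R : idomainType) (a b l : R) : Prop :=
  [/\ exists q, l = q * a, exists q, l = q * b &
      forall m, (exists q, m = q * a) -> (exists q, m = q * b) ->
        exists q, m = q * l].

Lemma pid_lcm (R : idomainType) (a b : R) : is_pid R -> exists l, is_lcm a b l.
Proof.
move=> /(_ [set m | (exists q, m = q * a) /\ exists q, m = q * b]) [].
  split=> [|x y [[p ->] [q xb]] [[r ->] [s yb]]|c x [[p ->] [q xb]]|c x [[p ->] [q xb]]].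
  - by split; exists 0; rewrite mul0r.
  - by split; [exists (p + r) | exists (q + s)]; rewrite mulrDl // xb yb.
  - by split; [exists (c * p) | exists (c * q)]; rewrite -mulrA // xb.
  - by rewrite mulrC; split; [exists (c * p) | exists (c * q)]; rewrite -mulrA // xb.
move=> l Il; exists l.
have [la lb] : (exists q, l = q * a) /\ (exists q, l = q * b).
  have : [set m | (exists q, m = q * a) /\ exists q, m = q * b] l.
    by rewrite Il; exists 1 => //; rewrite mul1r.
  by [].
split=> // m ma mb.
have : [set m | (exists q, m = q * a) /\ exists q, m = q * b] m by [].
by rewrite Il => -[q _ <-]; exists q.
Qed.

Definition associated (R : idomainType) (a b : R) : Prop :=
  exists2 w : R, w \is a GRing.unit & a = w * b.

(* The q such that q * b = a, if there is one; it is unique for b != 0. *)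
Definition exact_quo (R : idomainType) (a b : R) : R :=
  xget 0 [set q | q * b = a].

(* The polynomial B_W of the pair (f, h), where l is a chosen least common
   multiple of the leading coefficients of f and h. *)
Definition B_W (R : idomainType) (S : nzRingType) (iota : {rmorphism R -> S})
    (n : nat) (Y : 'I_n -> S) (lt : rel 'X_{1..n}) (l : R) (f h : S) : S :=
  let T := lead_term iota Y lt in
  let lc := lead_coeff iota Y lt in
  let t := mlcm (T f) (T h) in
  iota (exact_quo l (lc h)) * (h * term Y (t - T h)%MM) -
  iota (exact_quo l (lc f)) * (f * term Y (t - T f)%MM).

(* Main.v *)
(** The variables commute with each other, so right multiplication by a term
    and left multiplication by a scalar act on coordinates as in the commutative
    polynomial ring over [R]; hence the claims only concern that ring. Write
    [c_k tau_k + r_k] for the coordinates of [g_k]. In the coprime case [B_W] is,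
    up to a unit, [r_j diamond g_i - r_i diamond g_j], and expanding [r_j] and
    [r_i] into monomials gives the representation. The leading terms of the two
    products differ, because [T(r_j) tau_i = T(r_i) tau_j] would make [tau_j]
    divide the smaller term [T(r_j)]; so nothing cancels above [T(B_W)]. *)
Require Import Defs.
From HB Require Import structures.
From mathcomp Require Import all_boot all_order all_algebra.
From mathcomp Require Import zify ring.
From mathcomp Require Import boolp classical_sets.
From mathcomp.multinomials Require Import mpoly.

Set Implicit Arguments.
Unset Strict Implicit.
Unset Printing Implicit Defensive.

Local Open Scope ring_scope.

Import GRing.Theory.
Local Open Scope classical_set_scope.

Section Tower.
Variables (R : idomainType) (S : nzRingType) (iota : {rmorphism R -> S}).
Variables (n : nat) (Y : 'I_n -> S) (alpha delta : 'I_n -> S -> S).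
Variable A : nat -> set S.
Hypothesis iota_inj : injective iota.
Hypothesis towerA : ore_tower iota Y alpha delta A.

Lemma tower_subring k : (k <= n)%N -> subring (A k).
Proof.
case: k => [_|k lt_kn]; last first.
  exact: oe_subB (ot_step towerA (Ordinal lt_kn)).
rewrite (ot_base towerA); split.
- by exists 1; rewrite ?rmorph1.
- by move=> _ _ [a _ <-] [b _ <-]; exists (a - b); rewrite ?rmorphB.
- by move=> _ _ [a _ <-] [b _ <-]; exists (a * b); rewrite ?rmorphM.
Qed.

Lemma tower_le k l : (k <= l)%N -> (l <= n)%N -> A k `<=` A l.
Proof.
elim: l => [|l IHl]; first by rewrite leqn0 => /eqP-> _ x.
rewrite leq_eqVlt => /predU1P[-> _ x|le_kl lt_ln] //.
apply: subset_trans (oe_incl (ot_step towerA (Ordinal lt_ln))).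
exact: IHl (ltnW lt_ln).
Qed.

Lemma vars_comm i j : GRing.comm (Y i) (Y j).
Proof.
suff comm_lt (a b : 'I_n) : (a < b)%N -> Y b * Y a = Y a * Y b.
  by case: (ltngtP i j) => [/comm_lt|/comm_lt|/val_inj->].
move=> lt_ab; have := oe_comm (ot_step towerA b) (a := Y a).
rewrite (ot_alpha_var towerA lt_ab) (ot_delta_var towerA lt_ab) addr0; apply.
exact/(tower_le lt_ab (ltnW (ltn_ord b)))/(oe_var (ot_step towerA a)).
Qed.

Lemma prod_comm (I : Type) (s : seq I) (a b : I -> S) :
    (forall i j, GRing.comm (a i) (b j)) ->
  \prod_(i <- s) (a i * b i) = (\prod_(i <- s) a i) * \prod_(i <- s) b i.
Proof.
move=> ab; elim: s => [|i s IHs]; first by rewrite !big_nil mulr1.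
rewrite !big_cons IHs !mulrA; congr (_ * _); rewrite -!mulrA; congr (_ * _).
by apply: commr_prod => j _; apply/commr_sym/ab.
Qed.

Lemma termD m1 m2 : term Y (m1 + m2) = term Y m1 * term Y m2.
Proof.
rewrite /term -prod_comm => [|i j].
  by apply: eq_bigr => i _; rewrite mnmDE exprD.
exact/commrX/commr_sym/commrX/vars_comm.
Qed.

Lemma term_varX i k : term Y (U_(i) *+ k) = Y i ^+ k.
Proof.
elim: k => [|k IHk]; first by rewrite mulm0n expr0; apply: mmap11.
by rewrite mulmS termD IHk exprS; congr (_ * _); apply: mmap1U.
Qed.

(* [of_coords iota Y] is convertible to [mmap iota Y]; only additivity and
   [iota]-linearity of [mmap] are available, as [S] is not commutative. *)
Lemma of_coordsMX p m :
  of_coords iota Y (p * 'X_[m]) = of_coords iota Y p * term Y m.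
Proof.
rewrite [in LHS](mpolyE p) mulr_suml [LHS](raddf_sum (mmap iota Y)) /=.
rewrite /of_coords mulr_suml; apply: eq_bigr => m1 _.
by rewrite -scalerAl -mpolyXD mmapZ mmapX -mulrA; congr (_ * _); apply: termD.
Qed.

Lemma tower_coords k x :
  (k <= n)%N -> A k x -> exists p, of_coords iota Y p = x.
Proof.
elim: k x => [|k IHk] x.
  by rewrite (ot_base towerA) => _ [r _ <-]; exists r%:MP; apply: mmapC.
move=> lt_kn /(oe_free (ot_step towerA (Ordinal lt_kn)))[q [[Aq ->] _]].
have /choice[p pq] : forall j, exists p, of_coords iota Y p = q`_j.
  by move=> j; apply: IHk (ltnW lt_kn) (Aq j).
exists (\sum_(j < size q) p j * 'X_[U_(Ordinal lt_kn) *+ j]).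
rewrite [LHS](raddf_sum (mmap iota Y)) /= horner_coef; apply: eq_bigr => j _.
by rewrite -pq -term_varX -of_coordsMX.
Qed.

Let in_first_vars k (p : {mpoly R[n]}) :=
  forall m, m \in msupp p -> forall i : 'I_n, (k <= i)%N -> m i = 0%N.

Lemma tower_of_coords k p :
  (k <= n)%N -> in_first_vars k p -> A k (of_coords iota Y p).
Proof.
move=> le_kn pk; have [A1 AB AM] := tower_subring le_kn.
have A0 : A k 0 by rewrite -(subrr 1); apply: AB.
have AD x y : A k x -> A k y -> A k (x + y).
  by move=> Ax Ay; rewrite -[y]opprK -[- y]sub0r; apply: (AB) => //; apply: (AB).
rewrite /of_coords big_seq; apply: (big_ind (A k)) => // m /pk mk.
apply: (AM).
  by apply: (@tower_le 0%N k) => //; rewrite (ot_base towerA); exists p@_m.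
apply: (big_ind (A k)) => // i _; have [/mk->|lt_ik] := leqP k i.
  by rewrite expr0.
have AYi : A k (Y i) by apply: (tower_le lt_ik) (oe_var (ot_step towerA i)).
by elim: (m i) => [|e IHe]; rewrite ?expr0 // exprS; apply: (AM).
Qed.

Lemma mpoly_slices (i : 'I_n) (p : {mpoly R[n]}) :
  p = \sum_(j < msize p) (\sum_(m <- msupp p | m i == j)
        p@_m *: 'X_[m - U_(i) *+ j]) * 'X_[U_(i) *+ j].
Proof.
under eq_bigr do rewrite mulr_suml.
rewrite (exchange_big_dep xpredT) //= {1}[p]mpolyE big_seq [RHS]big_seq.
apply: eq_bigr => m mp.
have lt_mi : (m i < msize p)%N.
  by apply: leq_ltn_trans (msize_mdeg_lt mp); rewrite mdegE (bigD1 i) ?leq_addr.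
rewrite (big_pred1 (Ordinal lt_mi)) => [|j]; last first.
  by rewrite /= eq_sym -val_eqE.
rewrite -scalerAl -mpolyXD submK //; apply/mnm_lepP => l.
by rewrite mulmnE mnm1E /=; case: eqVneq => [->|_]; rewrite ?mul1n.
Qed.

Lemma tower_free k p : (k <= n)%N -> in_first_vars k p ->
  of_coords iota Y p = 0 -> p = 0.
Proof.
elim: k p => [|k IHk] p.
  move=> _ p0.
  have -> : p = (p@_0)%:MP.
    apply/mpolyP => m; rewrite mcoeffC.
    have [<-|m0] := eqVneq; first by rewrite mulr1.
    rewrite mulr0; apply: memN_msupp_eq0; apply: contra m0 => /p0 m0.
    by apply/eqP/mnmP => i; rewrite mnm0E m0.
  rewrite [of_coords _ _ _](mmapC Y iota) => /eqP.
  by rewrite -(rmorph0 iota) => /eqP/iota_inj->; rewrite mpolyC0.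
move=> lt_kn pk; set i := Ordinal lt_kn.
pose slice j : {mpoly R[n]} :=
  \sum_(m <- msupp p | m i == j) p@_m *: 'X_[m - U_(i) *+ j].
have slice_k j : in_first_vars k (slice j).
  rewrite /slice big_seq_cond; apply: (big_ind (in_first_vars k)).
  - by move=> m; rewrite msupp0.
  - move=> a b ak bk m /msuppD_le; rewrite mem_cat => /orP[/ak|/bk] //.
  move=> m /andP[mp /eqP mi] m1 /msuppZ_le; rewrite msuppX inE => /eqP-> l.
  rewrite mnmBE mulmnE mnm1E leq_eqVlt -[k]/(val i) val_eqE.
  case/predU1P=> [<-|/= lt_kl]; first by rewrite eqxx mul1n mi subnn.
  by rewrite (pk m mp l lt_kl) sub0n.
have p_slices : p = \sum_(j < msize p) slice j * 'X_[U_(i) *+ j].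
  exact: mpoly_slices.
pose q := \poly_(j < msize p) of_coords iota Y (slice j).
move=> p0.
have A0 : A k.+1 0 by rewrite -p0; apply: tower_of_coords.
have Ak0 : A k 0.
  rewrite -[0](_ : of_coords iota Y 0 = 0); last exact: (mmap0 Y iota).
  by apply: tower_of_coords (ltnW lt_kn) _ => m; rewrite msupp0.
have [q0 [_ uniq_q0]] := oe_free (ot_step towerA i) A0.
have q_eq0 : q = 0.
  rewrite -[q](uniq_q0 q) -1?[0 in RHS](uniq_q0 0) //.
    by split=> [j|]; rewrite ?coef0 ?horner0.
  split=> [j|].
    by rewrite coef_poly; case: ifP => // _; apply: tower_of_coords (ltnW lt_kn) _.
  rewrite horner_poly -[LHS]p0 [in LHS]p_slices.
  rewrite [LHS](raddf_sum (mmap iota Y)) /=.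
  by apply: eq_bigr => j _; rewrite -term_varX -of_coordsMX.
rewrite p_slices big1 // => j _; rewrite (IHk (slice j)) ?mul0r ?(ltnW lt_kn) //.
by have := coef_poly (msize p) (fun j => of_coords iota Y (slice j)) j;
  rewrite -/q q_eq0 coef0 ltn_ord.
Qed.

End Tower.

Section Coordinates.
Variables (R : idomainType) (S : nzRingType) (iota : {rmorphism R -> S}).
Variables (n : nat) (Y : 'I_n -> S) (alpha delta : 'I_n -> S -> S).
Hypothesis oreS : multivariate_ore iota Y alpha delta.

Lemma ore_of_coordsMX p m :
  of_coords iota Y (p * 'X_[m]) = of_coords iota Y p * term Y m.
Proof. by have [_ [A towerA]] := oreS; apply: of_coordsMX towerA _ _. Qed.

Lemma coordsK : cancel (coords iota Y) (of_coords iota Y).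
Proof.
move=> f; have [_ [A towerA]] := oreS.
have [p pf] : exists p, of_coords iota Y p = f.
  by apply: (tower_coords towerA (leqnn n)); rewrite (ot_top towerA).
exact: (@xgetPex _ 0 [set p | of_coords iota Y p = f]) (ex_intro _ p pf).
Qed.

Lemma of_coords_inj : injective (of_coords iota Y).
Proof.
move=> p q pq; have [iota_inj [A towerA]] := oreS.
apply/eqP; rewrite -subr_eq0; apply/eqP.
apply: (tower_free iota_inj towerA (leqnn n)).
  by move=> m _ i; rewrite leqNgt ltn_ord.
by rewrite [LHS](mmapB Y iota) [X in X - _]pq; apply: subrr.
Qed.

Lemma of_coordsK : cancel (of_coords iota Y) (coords iota Y).
Proof. by move=> p; apply: of_coords_inj; rewrite coordsK. Qed.

Lemma of_coords_monomial a f m :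
  of_coords iota Y (a *: (coords iota Y f * 'X_[m])) = iota a * (f * term Y m).
Proof.
rewrite [LHS](mmapZ Y iota); congr (_ * _).
by rewrite -[in RHS](coordsK f) -ore_of_coordsMX.
Qed.

Lemma of_coordsZX a m :
  of_coords iota Y (a *: 'X_[m]) = iota a * term Y m.
Proof. by rewrite [LHS](mmapZ Y iota) mmapX. Qed.

End Coordinates.

Section TermOrder.
Variables (n : nat) (lt : rel 'X_{1..n}).
Hypothesis lt_order : term_order lt.
Local Notation le := (le_term lt).

Lemma le_term_trans : transitive le.
Proof.
move=> b a c /predU1P[->//|lt_ab] /predU1P[<-|lt_bc]; apply/orP; right => //.
exact: to_trans lt_order _ _ _ lt_ab lt_bc.
Qed.

Lemma le_lt_term_trans b a c : le a b -> lt b c -> lt a c.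
Proof. by move=> /predU1P[->//|]; apply: to_trans lt_order _ _ _. Qed.

Lemma le_term_lt_false a b : le a b -> lt b a -> False.
Proof. by move=> ab /(le_lt_term_trans ab); rewrite (to_irr lt_order). Qed.

Lemma le_termD2r c a b : le a b -> le (a + c)%MM (b + c)%MM.
Proof.
by move=> /predU1P[->|/(to_mul lt_order c) lt_ab]; apply/orP; [left|right].
Qed.

Lemma le_term0 m : le 0%MM m.
Proof.
have [->|m0] := eqVneq 0%MM m; first exact/orP/or_introl.
have /orP[lt0m|lt_m0] := to_total lt_order m0; first by apply/orP; right.
exfalso; elim/(well_founded_ind (to_wf lt_order)): m {m0} lt_m0 => m IHm lt_m0.
have lt_mm : lt (m + m)%MM m by rewrite -[X in lt _ X]add0m; apply: to_mul.
exact: IHm lt_mm (to_trans lt_order lt_mm lt_m0).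
Qed.

Lemma lem_le_term a b : (a <= b)%MM -> le a b.
Proof. by move=> /submK <-; rewrite -{1}[a]add0m le_termD2r ?le_term0. Qed.

Variable R : idomainType.
Implicit Types p q r : {mpoly R[n]}.

Definition leading p (a : 'X_{1..n}) :=
  p@_a != 0 /\ forall m, m \in msupp p -> le m a.

Lemma leading_max p : p != 0 ->
  leading p (\big[(fun a b => if lt a b then b else a) / 0%MM]_(m <- msupp p) m).
Proof.
rewrite -msupp_eq0 /leading -mcoeff_msupp => p0.
elim: (msupp p) p0 => // m s IHs _; rewrite big_cons.
have [->|/IHs[]] := eqVneq s [::].
  rewrite big_nil; have -> : lt m 0%MM = false.
    by apply/negP/(le_term_lt_false (le_term0 m)).
  by split=> [|k]; rewrite inE // => /eqP->; apply/orP; left.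
set b := bigop _ _ _ => bs s_le_b; have [lt_mb|nlt_mb] := ifPn (lt m b).
  split=> [|k]; rewrite inE ?bs ?orbT // => /predU1P[->|/s_le_b //].
  by apply/orP; right.
split=> [|k]; rewrite inE ?eqxx // => /predU1P[->|/s_le_b le_kb].
  by apply/orP; left.
apply: le_term_trans le_kb _; apply/orP; have [->|bm] := eqVneq b m; first by left.
by have := to_total lt_order bm; rewrite (negbTE nlt_mb) orbF; right.
Qed.

Lemma leadingM p q a b :
  leading p a -> leading q b -> leading (p * q) (a + b)%MM.
Proof.
move=> [pa le_pa] [qb le_qb]; split; last first.
  move=> m /msuppM_le/allpairsP[[m1 m2] /= [/le_pa le1 /le_qb le2 ->]].
  apply: le_term_trans (le_termD2r _ le1) _.
  by rewrite ![(a + _)%MM]addmC le_termD2r.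
rewrite mpolyME raddf_sum big_allpairs /=.
rewrite (bigD1_seq a) ?mcoeff_msupp ?msupp_uniq //=.
rewrite (bigD1_seq b) ?mcoeff_msupp ?msupp_uniq //=.
rewrite mcoeffZ mcoeffX eqxx mulr1 !big1_seq ?addr0 ?mulf_neq0 //.
- move=> m1 /andP[m1a /le_pa le1]; rewrite big1_seq // => m2 /le_qb le2.
  have lt1 : lt m1 a by move: le1; rewrite /le_term (negbTE m1a).
  rewrite mcoeffZ mcoeffX; case: eqP => [e|]; last by rewrite mulr0.
  have : lt (m1 + m2)%MM (a + b)%MM.
    apply: le_lt_term_trans (to_mul lt_order b lt1).
    by rewrite ![(m1 + _)%MM]addmC le_termD2r.
  by rewrite e (to_irr lt_order).
- move=> m2 /andP[m2b _]; rewrite mcoeffZ mcoeffX eqm_add2l (negbTE m2b).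
  by rewrite mulr0.
Qed.

Lemma leadingB p q a b : leading p a -> leading q b -> a != b ->
  exists2 m, (p - q)@_m != 0 & le a m.
Proof.
move=> [pa le_pa] [qb le_qb] ab; have /orP[lt_ab|lt_ba] := to_total lt_order ab.
  exists b; last by apply/orP; right.
  have [/le_pa/le_term_lt_false/(_ lt_ab) //|] := boolP (b \in msupp p).
  by move=> /memN_msupp_eq0 pb; rewrite mcoeffB pb sub0r oppr_eq0.
exists a; last by apply/orP; left.
have [/le_qb/le_term_lt_false/(_ lt_ba) //|] := boolP (a \in msupp q).
by move=> /memN_msupp_eq0 qa; rewrite mcoeffB qa subr0.
Qed.

Definition tail p a := p - p@_a *: 'X_[a].

Lemma tail_lt p a m : leading p a -> m \in msupp (tail p a) -> lt m a.
Proof.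
move=> [_ le_pa]; rewrite mcoeff_msupp mcoeffB mcoeffZ mcoeffX.
have [->|am] := eqVneq a m; first by rewrite mulr1 subrr eqxx.
rewrite mulr0 subr0 -mcoeff_msupp => /le_pa.
by rewrite /le_term eq_sym (negbTE am).
Qed.

Lemma tail_syzygy_no_cancel p q a b m : leading p a -> leading q b ->
    mlcm a b = (a + b)%MM -> m \in msupp (tail q b) ->
  exists2 k, (tail q b * p - tail p a * q)@_k != 0 & le (a + m)%MM k.
Proof.
move=> pa qb coprime_ab ms.
have [|s_lead s_le] := @leading_max (tail q b).
  by apply: contraTneq ms => ->; rewrite msupp0.
set e := bigop _ _ _ in s_lead s_le.
have sp : leading (tail q b * p) (e + a)%MM by apply: leadingM.
have le_ae : le (a + m)%MM (e + a)%MM by rewrite addmC le_termD2r ?s_le.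
have [->|r0] := eqVneq (tail p a) 0.
  by rewrite mul0r subr0; exists (e + a)%MM => //; case: sp.
have rq := leadingM (leading_max r0) qb; set f := bigop _ _ _ in rq.
suff ef : (e + a)%MM != (f + b)%MM.
  have [k Dk le_k] := leadingB sp rq ef.
  by exists k => //; apply: le_term_trans le_ae le_k.
apply/eqP => /mnmP ef; have lt_eb : lt e b.
  by apply: (tail_lt qb); rewrite mcoeff_msupp.
apply: le_term_lt_false lt_eb; apply/lem_le_term/mnm_lepP => i.
move/mnmP/(_ i): coprime_ab; move: (ef i); rewrite !mnmE /=.
by case: (a i) => [|a'] /=; [rewrite addn0 => ->; rewrite leq_addl|]; lia.
Qed.

End TermOrder.

Lemma exact_quoK (R : idomainType) (a b : R) : b != 0 -> exact_quo (a * b) b = a.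
Proof.
move=> b0; have := @xgetPex _ 0 [set q | q * b = a * b] (ex_intro _ a erefl).
exact: mulIf.
Qed.

Theorem lemma70
    (R : idomainType) (hR : is_pid R)
    (V : choiceType) (I : set (free_ring V)) (pi : {rmorphism free_ring V -> R})
    (hpi : presentation I pi)
    (S : nzRingType) (iota : {rmorphism R -> S})
    (n : nat) (Y : 'I_n -> S) (alpha delta : 'I_n -> S -> S)
    (hS : multivariate_ore iota Y alpha delta)
    (lt : rel 'X_{1..n}) (hlt : term_order lt) (hfin : finite_below lt)
    (u : nat) (g : 'I_u -> S) (hg : forall k, g k != 0)
    (hI : two_sided_ideal (I_W iota Y g))
    (hY : forall (k : 'I_u) (i : 'I_n), restricted_rep iota Y lt g (Y i * g k))
    (hv : forall (k : 'I_u) (v : V) (w : 'X_{1..n}),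
       lt w (lead_term iota Y lt (g k)) ->
       restricted_rep iota Y lt g
         (g k * alpha_term alpha w (iota (pi (free_gen v)))))
    (i j : 'I_u) (hij : (i < j)%N) :
  let tau k := lead_term iota Y lt (g k) in
  let c k := lead_coeff iota Y lt (g k) in
  let M k := lead_mon iota Y lt (g k) in
  forall l : R, is_lcm (c i) (c j) l ->
  ((exists2 w : R, w \is a GRing.unit &
      diamond iota Y (M i) (M j) =
        iota w * (iota l * term Y (mlcm (tau i) (tau j))))
   <-> (mlcm (tau i) (tau j) = (tau i + tau j)%MM /\ associated l (c i * c j)))
  /\ (mlcm (tau i) (tau j) = (tau i + tau j)%MM /\ associated l (c i * c j) ->
      restricted_NF iota Y lt g (B_W iota Y lt l (g i) (g j)) 0).
Proof.
move=> tau c M l _.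
pose P k := coords iota Y (g k).
have PK k : of_coords iota Y (P k) = g k by apply: coordsK hS _.
have P_lead k : leading lt (P k) (tau k).
  apply: leading_max => //; apply: contra_neq (hg k) => P0.
  by rewrite -PK P0; apply: mmap0 Y iota.
have c_neq0 k : c k != 0 by case: (P_lead k).
have ME k : M k = of_coords iota Y (c k *: 'X_[tau k]) by rewrite of_coordsZX.
split.
  have MME : diamond iota Y (M i) (M j) =
             of_coords iota Y ((c i * c j) *: 'X_[tau i + tau j]).
    rewrite /diamond !ME !(of_coordsK hS) -scalerAl -scalerAr scalerA.
    by rewrite -mpolyXD.
  split=> [[w w_unit]|[-> [w w_unit ->]]]; last first.
    exists w^-1; rewrite ?unitrV // MME of_coordsZX.
    by rewrite [in RHS]mulrA -rmorphM mulKr.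
  rewrite MME mulrA -rmorphM -of_coordsZX => /(of_coords_inj hS) MM.
  have tauE : mlcm (tau i) (tau j) = (tau i + tau j)%MM.
    apply/eqP/negPn/negP => tauN; move/mpolyP/(_ (tau i + tau j)%MM)/eqP: MM.
    rewrite !mcoeffZ !mcoeffX eqxx (negbTE tauN) mulr1 mulr0.
    by rewrite mulf_eq0 (negbTE (c_neq0 i)) (negbTE (c_neq0 j)).
  split=> //; exists w^-1; rewrite ?unitrV //.
  move/mpolyP/(_ (tau i + tau j)%MM): MM.
  by rewrite tauE !mcoeffZ !mcoeffX eqxx !mulr1 => ->; rewrite mulKr.
move=> [tauE [w w_unit l_eq]]; split; last by rewrite eqxx.
have w_neq0 : w != 0 by apply: contraTneq w_unit => ->; rewrite unitr0.
pose r k := tail (P k) (tau k).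
have rE k : r k = P k - (c k)%:MP * 'X_[tau k] by rewrite mul_mpolyC.
pose D := r j * P i - r i * P j.
have BE : B_W iota Y lt l (g i) (g j) = of_coords iota Y (w *: D).
  rewrite /B_W -/(tau i) -/(tau j) -/(c i) -/(c j) tauE addmK.
  rewrite [X in (X - tau i)%MM]addmC addmK.
  have -> : exact_quo l (c j) = w * c i.
    by rewrite l_eq mulrA exact_quoK.
  have -> : exact_quo l (c i) = w * c j.
    by rewrite l_eq [c i * _]mulrC mulrA exact_quoK.
  rewrite -!(of_coords_monomial hS) -/(P i) -/(P j).
  rewrite -[LHS](mmapB Y iota); congr (of_coords iota Y _).
  by rewrite /D !rE -!mul_mpolyC !mpolyCM; ring.
have D_le k m : D@_k != 0 -> le_term lt m k ->
    le_term lt m (lead_term iota Y lt (B_W iota Y lt l (g i) (g j))).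
  move=> Dk le_mk; apply: le_term_trans le_mk _ => //.
  rewrite /lead_term BE (of_coordsK hS).
  have wDk : (w *: D)@_k != 0 by rewrite mcoeffZ mulf_neq0.
  have [|_] := @leading_max _ _ hlt _ (w *: D).
    by apply: contraNneq wDk => ->; rewrite mcoeff0.
  by apply; rewrite mcoeff_msupp.
pose rep (e : R) k h : seq (R * 'I_u * 'X_{1..n}) :=
  [seq (e * (r k)@_m, h, m) | m <- msupp (r k)].
have sum_rep e k h :
    \sum_(x <- rep e k h) iota x.1.1 * (g x.1.2 * term Y x.2) =
    of_coords iota Y (e *: (r k * P h)).
  rewrite big_map /= [r k in RHS]mpolyE mulr_suml scaler_sumr.
  rewrite [RHS](raddf_sum (mmap iota Y)); apply: eq_bigr => m _.
  rewrite -(of_coords_monomial hS) -scalerAl scalerA.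
  by rewrite [coords _ _ _ * _]mulrC.
exists (rep w j i ++ rep (- w) i j); split.
  rewrite subr0 big_cat /= !sum_rep -[RHS](mmapD Y iota) BE.
  by congr (of_coords iota Y _); rewrite scaleNr -scalerBr.
rewrite subr0 => x; rewrite mem_cat => /orP[] /mapP[m m_r ->] /=.
  split; first by rewrite mulf_neq0 // -mcoeff_msupp.
  have [k Dk le_k] := tail_syzygy_no_cancel hlt (P_lead i) (P_lead j) tauE m_r.
  exact: D_le Dk le_k.
split; first by rewrite mulf_neq0 ?oppr_eq0 // -mcoeff_msupp.
have tauE' : mlcm (tau j) (tau i) = (tau j + tau i)%MM by rewrite mlcmC tauE addmC.
have [k Dk le_k] := tail_syzygy_no_cancel hlt (P_lead j) (P_lead i) tauE' m_r.
by apply: D_le le_k; rewrite /D -opprB mcoeffN oppr_eq0.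
Qed.
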